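(* Let $f$ be a piecewise expanding $C^2$ unimodal map and let $X:I\to\mathbb R$ be bounded. Let $\alpha_{(0)}$ be the unique bounded function on $I$ with $\alpha_{(0)}(c)=0$ and $X(f(x))=\alpha_{(0)}(f(x))-f'(x)\alpha_{(0)}(x)$ for all $x\in I$, $x\ne c$. Then $$\mathcal J(f,X)=s_1\bigl(X(c_1)-\alpha_{(0)}(c_1)\bigr),\qquad\text{where}\quad \mathcal J(f,X)=\sum_{n=1}^{N_f}s_nX(c_n).$$
   Context: Fix $I=[a,b]$, $a<c<b$, $I_+=[a,c]$, $I_-=[c,b]$. For $r\ge1$, a piecewise expanding $C^r$ unimodal map is a continuous $f:I\to I$, strictly increasing on $I_+$, strictly decreasing on $I_-$, with $f(a)=f(b)=a$, such that for $\sigma=\pm$ the map $f|_{I_\sigma}$ extends to a $C^r$ map on a neighbourhood of $I_\sigma$ and $\inf|f'|_{I_\sigma}|>1$. Put $c_k=f^k(c)$. $N_f$: if $c$ is periodic of minimal period $n_1\ge2$, $N_f=n_1$. If $c$ is not periodic but some iterate is, let $n_0$ be minimal with $c_{n_0}$ periodic and $n_1$ the minimal period of $c_{n_0}$; then $N_f=n_0+n_1-1$. Otherwise $N_f=\infty$. $f$ has a unique absolutely continuous invariant probability measure; its density $\rho_0$ (extended by $0$ to $\mathbb R$) has bounded variation and is continuous off $\{c_k\mid k\ge1\}$. Its jumps are $s_n=\lim_{y\downarrow c_n}\rho_0(y)-\lim_{x\uparrow c_n}\rho_0(x)$. The function $\alpha_{(0)}$ is given explicitly by: $\alpha_{(0)}(c)=0$;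 $\alpha_{(0)}(x)=-\sum_{j=0}^{\infty}\frac{X(f^{j+1}(x))}{(f^{j+1})'(x)}$ if $f^j(x)\ne c$ for all $j\ge0$; and $\alpha_{(0)}(x)=-\sum_{j=0}^{\ell-1}\frac{X(f^{j+1}(x))}{(f^{j+1})'(x)}$ if $x\neq c$ and $\ell\ge1$ is minimal with $f^\ell(x)=c$. Here $(f^{j})'(x)=\prod_{i<j}f'(f^i(x))$. *)

(* Defs.v *)
From HB Require Import structures.
From mathcomp Require Import all_boot all_order all_algebra.
From mathcomp Require Import all_classical all_reals all_analysis.

Set Implicit Arguments.
Unset Strict Implicit.
Unset Printing Implicit Defensive.

Import Order.TTheory GRing.Theory Num.Theory.
Import numFieldNormedType.Exports.

Local Open Scope classical_set_scope.
Local Open Scope ring_scope.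

(* A map I -> I or I -> R, with I = [a, b], is represented by a total function
   R -> R whose values off I are irrelevant to all the notions below. *)

Section Unimodal.
Context {R : realType}.
Implicit Types (D U : set R) (f g : R -> R) (a b c x : R).

(* The derivative of the restriction of f to D; on an interval this is the
   one-sided derivative at the endpoints. *)
Definition derive_in D f x : R :=
  lim ((fun y => (f y - f x) / (y - x)) @ within D x^').

Definition Cr_on (r : nat) U g : Prop :=
  (forall k, (k < r)%N -> forall x, U x -> derivable (derive1n k g) x 1) /\
  (forall x, U x -> {for x, continuous (derive1n r g)}).

Definition extends_Cr (r : nat) D f : Prop :=
  exists U g, [/\ open U, D `<=` U, (forall x, D x -> g x = f x) & Cr_on r U g].

Record piecewise_expanding_unimodal (r : nat) a c b f : Prop := {
  unimodal_lt_ac : a < c;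
  unimodal_lt_cb : c < b;
  unimodal_maps : forall x, x \in `[a, b] -> f x \in `[a, b];
  unimodal_continuous : {within `[a, b], continuous f};
  unimodal_increasing : {in `[a, c] &, {homo f : x y / x < y}};
  unimodal_decreasing : {in `[c, b] &, {homo f : x y / x < y >-> y < x}};
  unimodal_left_end : f a = a;
  unimodal_right_end : f b = a;
  unimodal_Cr_left : extends_Cr r `[a, c] f;
  unimodal_Cr_right : extends_Cr r `[c, b] f;
  unimodal_expanding_left :
    1 < inf [set `|derive_in `[a, c] f x| | x in `[a, c]];
  unimodal_expanding_right :
    1 < inf [set `|derive_in `[c, b] f x| | x in `[c, b]]
}.

Definition bounded_on D (u : R -> R) : Prop :=
  exists M : R, forall x, D x -> `|u x| <= M.

End Unimodal.

Section PostcriticalLength.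
Context {R : realType}.
Implicit Types (f : R -> R) (c x : R).

Definition least (P : set nat) : nat :=
  xget 0%N [set n | P n /\ forall m, P m -> (n <= m)%N].

Definition periodic f x : Prop := exists p, (0 < p)%N /\ iter p f x = x.

Definition min_period f x : nat :=
  least [set p | (0 < p)%N /\ iter p f x = x].

Definition preperiod f x : nat := least [set n | periodic f (iter n f x)].

(* None stands for the value infinity.  For a piecewise expanding unimodal map
   the minimal period of a periodic c is automatically at least 2. *)
Definition Nf f c : option nat :=
  if pselect (periodic f c) then Some (min_period f c)
  else if pselect (exists n, periodic f (iter n f c)) then
    let n0 := preperiod f c in
    Some (n0 + min_period f (iter n0 f c) - 1)%N
  else None.

End PostcriticalLength.

Section InvariantDensity.
Context {R : realType}.
Implicit Types (f rho : R -> R) (a b c x : R).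

Definition is_acip a b f (mu : probability (measurableTypeR R) R) : Prop :=
  [/\ mu `<< lebesgue_measure,
      mu `[a, b]%classic = 1%E &
      forall A : set (measurableTypeR R), measurable A ->
        mu (`[a, b]%classic `&` f @^-1` A) = mu A].

Definition is_density (mu : probability (measurableTypeR R) R) rho : Prop :=
  lebesgue_measure.-integrable setT (EFin \o rho) /\
  forall A : set (measurableTypeR R), measurable A ->
    mu A = (\int[lebesgue_measure]_(x in A) (rho x)%:E)%E.

Definition bounded_variation_line rho : Prop :=
  exists M : R, forall u v, u <= v -> (total_variation u v rho <= M%:E)%E.

(* The version of the density of mu, defined on the whole line, in terms of
   which the jumps are defined.  Two such versions have the same one-sided
   limits everywhere. *)
Record is_BV_density a c b f mu rho : Prop := {
  BV_density_density : is_density mu rho;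
  BV_density_off_I : forall x, x \notin `[a, b] -> rho x = 0;
  BV_density_bounded_variation : bounded_variation_line rho;
  BV_density_continuous : forall x,
    (forall k, (0 < k)%N -> x <> iter k f c) -> {for x, continuous rho}
}.

Definition jump rho x : R := lim (rho @ x^'+) - lim (rho @ x^'-).

Definition jump_term f c rho (X : R -> R) (n : nat) : R :=
  jump rho (iter n f c) * X (iter n f c).

Definition jump_partial_sum f c rho X (m : nat) : R :=
  \sum_(1 <= n < m.+1) jump_term f c rho X n.

(* When N_f is infinite, J is the sum of a series, and is meaningful only if
   J_converges holds. *)
Definition J_converges f c rho X : Prop :=
  if Nf f c is Some _ then True else cvgn (jump_partial_sum f c rho X).

Definition J f c rho X : R :=
  if Nf f c is Some m then jump_partial_sum f c rho X m
  else limn (jump_partial_sum f c rho X).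

Definition is_alpha0 a c b f (X alpha : R -> R) : Prop :=
  [/\ bounded_on `[a, b] alpha,
      alpha c = 0 &
      forall x, x \in `[a, b] -> x != c ->
        X (f x) = alpha (f x) - derive_in `[a, b] f x * alpha x].

End InvariantDensity.

(* Main.v *)
(** Idea. Let F be the distribution function of mu. If x <= c <= x' and
    f x = f x', invariance of mu gives F (f x) = F x + 1 - F x'. Since rho0 has
    bounded variation, its one-sided limits exist and are the one-sided
    derivatives of F; differentiating the relation from both sides yields
      jump (f x) = jump x / f' x + jump x' / f' x'.
    As rho0 jumps only on the orbit of c, this reads s_(n+1) = s_n / f' (c_n)
    whenever c_n is the only preimage of c_(n+1) on that orbit. With the
    cohomological equation, s_(n+1) X (c_(n+1)) is then the increment of
    s_n alpha0 (c_n), and J telescopes: the last term vanishes because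
    alpha0 c = 0 when c is periodic and because s_n decays geometrically when
    the orbit is infinite; when c is strictly preperiodic it is cancelled by the
    second orbit preimage of c_(n_0).
    The equation itself says that alpha0 is fixed by the contraction
    alpha |-> (alpha \o f - X \o f) / f', with value 0 at c. *)
Require Import Defs.
From HB Require Import structures.
From mathcomp Require Import all_boot all_order all_algebra.
From mathcomp Require Import all_classical all_reals all_analysis.
From mathcomp Require Import ring lra zify.
Import Order.TTheory GRing.Theory Num.Theory.
Import numFieldNormedType.Exports.
Local Open Scope classical_set_scope.
Local Open Scope ring_scope.
Set Implicit Arguments.
Unset Strict Implicit.
Unset Printing Implicit Defensive.

(** * Distribution functions with densities of bounded variation *)

Section OneSidedLimits.
Context {R : realType}.
Implicit Types (g rho : R -> R) (x y u v L e : R).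

Lemma homo_cvg_at_right g u v x : u < x -> x < v ->
  {in `[u, v] &, {homo g : y z / y <= z}} -> cvg (g @ x^'+).
Proof.
move=> ux xv ndg; apply: nondecreasing_at_right_is_cvgr.
- near=> s => y z yxs zxs yz.
  have sv : s <= v by near: s; exact: nbhs_right_le.
  move: yxs zxs; rewrite !in_itv/= => /andP[xy ys] /andP[xz zs].
  by apply: ndg => //; rewrite in_itv/=; apply/andP; split; lra.
- near=> s; exists (g x) => _ [y + <-]; rewrite /= in_itv/= => /andP[xy ys].
  have sv : s <= v by near: s; exact: nbhs_right_le.
  by apply: ndg; rewrite ?in_itv/=; first [exact: ltW|apply/andP; split; lra].
Unshelve. all: by end_near. Qed.

Lemma homo_cvg_at_left g u v x : u < x -> x < v ->
  {in `[u, v] &, {homo g : y z / y <= z}} -> cvg (g @ x^'-).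
Proof.
move=> ux xv ndg; apply: nondecreasing_at_left_is_cvgr.
- near=> s => y z yxs zxs yz.
  have us : u <= s by near: s; exact: nbhs_left_ge.
  move: yxs zxs; rewrite !in_itv/= => /andP[xy ys] /andP[xz zs].
  by apply: ndg => //; rewrite in_itv/=; apply/andP; split; lra.
- near=> s; exists (g x) => _ [y + <-]; rewrite /= in_itv/= => /andP[xy ys].
  have us : u <= s by near: s; exact: nbhs_left_ge.
  by apply: ndg; rewrite ?in_itv/=; first [exact: ltW|apply/andP; split; lra].
Unshelve. all: by end_near. Qed.

Lemma bounded_variation_line_itv rho u v : bounded_variation_line rho ->
  u <= v -> bounded_variation u v rho.
Proof.
move=> [M rhoM] uv; apply/bounded_variationP => //.
rewrite ge0_fin_numE ?total_variation_ge0//.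
by rewrite (le_lt_trans (rhoM _ _ uv))// ltry.
Qed.

(** By Jordan decomposition [rho] is, near x, a difference of two nondecreasing functions, and each
    of these has one-sided limits. *)
Lemma bounded_variation_line_cvg rho x : bounded_variation_line rho ->
  cvg (rho @ x^'+) /\ cvg (rho @ x^'-).
Proof.
move=> bv; have ltm1 : x - 1 < x by lra.
have ltp1 : x < x + 1 by lra.
have bvx : bounded_variation (x - 1) (x + 1) rho.
  by apply: bounded_variation_line_itv => //; lra.
have rhoE := bounded_variation_pos_neg_tvE bvx.
have ndn := fine_neg_tv_nondecreasing bvx.
have ndp : {in `[x - 1, x + 1] &,
    {homo (fine \o pos_tv (x - 1) rho) : y z / y <= z}}.
  exact/fine_neg_tv_nondecreasing/bounded_variationN.
split.
- have /cvg_ex[/= l pl] := homo_cvg_at_right ltm1 ltp1 ndp.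
  have /cvg_ex[/= m nm] := homo_cvg_at_right ltm1 ltp1 ndn.
  apply/cvg_ex; exists (l - m); apply: cvg_trans (cvgB pl nm).
  apply: near_eq_cvg; near=> y; rewrite rhoE// in_itv/=; apply/andP; split.
    by rewrite (@le_trans _ _ x) ?ltW.
  by near: y; exact: nbhs_right_le.
- have /cvg_ex[/= l pl] := homo_cvg_at_left ltm1 ltp1 ndp.
  have /cvg_ex[/= m nm] := homo_cvg_at_left ltm1 ltp1 ndn.
  apply/cvg_ex; exists (l - m); apply: cvg_trans (cvgB pl nm).
  apply: near_eq_cvg; near=> y; rewrite rhoE// in_itv/=; apply/andP; split.
    by near: y; exact: nbhs_left_ge.
  by rewrite (@le_trans _ _ x) ?ltW.
Unshelve. all: by end_near. Qed.

End OneSidedLimits.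

Section CumulativeMass.
Context {R : realType}.
Variable mu : probability (measurableTypeR R) R.
Implicit Types (rho : R -> R) (x y u v L e : R).

(** The distribution function F of [mu]; [fine] loses nothing because [mu] is finite. *)
Definition mass x : R := fine (mu (`]-oo, x]%classic : set R)).

Lemma is_density_set1 rho x : is_density mu rho -> mu [set x] = 0%E.
Proof.
move=> [_ ->]; last exact: measurable_set1.
by rewrite integral_set1.
Qed.

(** A density makes points null, so the interval may be taken open. This matters because one-sided
    limits of [rho] say nothing about its values at the endpoints. *)
Lemma massB rho x u : is_density mu rho -> x < u ->
  mass u - mass x = fine (mu (`]x, u[%classic : set R)).
Proof.
move=> drho xu.
rewrite /mass; have -> : (`]-oo, u]%classic : set R) =
    (`]-oo, x] `|` `]x, u[) `|` [set u].
  apply/seteqP; split => y /=; rewrite !in_itv/=.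
    case: (ltrgtP y u) => // [yu _|-> _]; [left|right] => //.
    by case: (lerP y x); [left|right].
  by move=> [[yx|/andP[_ /ltW//]]|->//]; rewrite (le_trans yx)// ltW.
rewrite !measureU//=.
- rewrite (is_density_set1 _ drho) adde0 fineD ?fin_num_measure//.
  by rewrite addrAC subrr add0r.
- apply/seteqP; split => y //=; rewrite !in_itv/= => -[yx /andP[xy _]].
  by move: xy; rewrite ltNge yx.
- by apply: measurableU.
- apply/seteqP; split => y //= -[+ yu]; rewrite yu !in_itv/= ltxx andbF.
  by rewrite leNgt xu => -[].
Qed.

End CumulativeMass.

Section MassDerivative.
Context {R : realType}.
Variable mu : probability (measurableTypeR R) R.
Implicit Types (rho : R -> R) (x y u v L e : R).

(** On ]x, u[ the density lies between L - e and L + e; integrating these constants encloses the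
    mean value of [rho]. *)
Lemma mass_slope_dist rho x u L e : is_density mu rho -> x < u ->
  (forall t, x < t < u -> `|L - rho t| <= e) ->
  `|L - (mass mu u - mass mu x) / (u - x)| <= e.
Proof.
move=> drho xu rhoL; have ux0 : 0 < u - x by rewrite subr_gt0.
have mE : mass mu u - mass mu x =
    (\int[lebesgue_measure]_(t in (`]x, u[%classic : set R)) rho t)%R.
  by rewrite (massB drho xu) (drho.2 _ (measurable_itv _)).
have lE : fine (lebesgue_measure (`]x, u[%classic : set R)) = u - x.
  by rewrite lebesgue_measure_itv/= lte_fin xu.
have irho : lebesgue_measure.-integrable (`]x, u[%classic : set R) (EFin \o rho).
  by apply: integrableS drho.1.
have icst k : lebesgue_measure.-integrable (`]x, u[%classic : set R)
    (EFin \o (fun=> k)).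
  apply/integrableP; split; first exact: measurable_cst.
  by rewrite /= integral_cst//= lebesgue_measure_itv/= lte_fin xu -EFinB -EFinM ltry.
have lower : (L - e) * (u - x) <= mass mu u - mass mu x.
  rewrite mE -lE -Rintegral_cst//; apply: le_Rintegral => // t.
  by rewrite /= in_itv/= => /rhoL; rewrite ler_distl; lra.
have upper : mass mu u - mass mu x <= (L + e) * (u - x).
  rewrite mE -lE -Rintegral_cst//; apply: le_Rintegral => // t.
  by rewrite /= in_itv/= => /rhoL; rewrite ler_distl; lra.
rewrite ler_distlC.
by rewrite ler_pdivlMr// ler_pdivrMr// lower.
Qed.

Lemma mass_slope_cvg_at_right rho x L : is_density mu rho ->
  rho @ x^'+ --> L ->
  (mass mu u - mass mu x) / (u - x) @[u --> x^'+] --> L.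
Proof.
move=> drho /cvgrPdist_le rhoL; apply/cvgrPdist_le => e e0.
have [d /= d0 rhod] := rhoL _ e0.
near=> u; apply: (mass_slope_dist drho) => // t /andP[xt tu].
apply: rhod => //=; rewrite ltr0_norm ?subr_lt0// opprB.
have : u < x + d by near: u; apply: nbhs_right_lt; lra.
lra.
Unshelve. all: by end_near. Qed.

Lemma mass_slope_cvg_at_left rho x L : is_density mu rho ->
  rho @ x^'- --> L ->
  (mass mu u - mass mu x) / (u - x) @[u --> x^'-] --> L.
Proof.
move=> drho /cvgrPdist_le rhoL; apply/cvgrPdist_le => e e0.
have [d /= d0 rhod] := rhoL _ e0.
(* The slope is symmetric in its two points, so the left case uses the same bound on the interval
   ]u, x[. *)
near=> u; rewrite -mulrNN -invrN !opprB.
apply: (mass_slope_dist drho) => // t /andP[ut tx].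
apply: rhod => //=; rewrite gtr0_norm ?subr_gt0//.
have : x - d < u by near: u; apply: nbhs_left_gt; lra.
lra.
Unshelve. all: by end_near. Qed.

End MassDerivative.

(** * Expanding branches and slopes of their inverses *)

Section Branch.
Context {R : realType}.
Implicit Types (f g phi F : R -> R) (p q x y u v : R).

Lemma derivable_slope_cvg g x : derivable g x 1 ->
  (g y - g x) / (y - x) @[y --> x^'] --> derive1 g x.
Proof.
move=> dg; rewrite derive1E; apply/cvgrPdist_le => e e0.
have /cvgrPdist_le/(_ _ e0)[d /= d0 gd] := dg.
exists d => //= y; rewrite /ball_/= (distrC x) => xy yx.
have := gd (y - x); rewrite /= sub0r normrN subr_eq0 => /(_ xy yx).
by rewrite /GRing.scale/= mulr1 subrK mulrC.
Qed.

(** This inclusion of filters lets a limit taken within [p, q], as in [derive_in], be read off along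
    one side. *)
Lemma at_right_within_itv p q x : p <= x -> x < q ->
  x^'+ `=>` within `[p, q]%classic x^'.
Proof.
move=> px xq A FA.
have {}FA : \forall y \near x^'+, `[p, q]%classic y -> A y.
  suff sub : x^'+ `=>` x^' by exact: sub FA.
  by apply: within_subset => y /= ?; rewrite gt_eqF.
near=> y; have xy : x < y by [].
have : `[p, q]%classic y -> A y by near: y.
apply; rewrite /= in_itv/=; apply/andP; split; first by lra.
by near: y; exact: nbhs_right_le.
Unshelve. all: by end_near. Qed.

Lemma at_left_within_itv p q x : p < x -> x <= q ->
  x^'- `=>` within `[p, q]%classic x^'.
Proof.
move=> px xq A FA.
have {}FA : \forall y \near x^'-, `[p, q]%classic y -> A y.
  suff sub : x^'- `=>` x^' by exact: sub FA.
  by apply: within_subset => y /= ?; rewrite lt_eqF.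
near=> y; have xy : y < x by [].
have : `[p, q]%classic y -> A y by near: y.
apply; rewrite /= in_itv/=; apply/andP; split; last by lra.
by near: y; exact: nbhs_left_ge.
Unshelve. all: by end_near. Qed.

(** Properness identifies the [lim] in [derive_in] with any limit that has been established, also at
    the endpoints, where only one side remains. *)
Lemma within_itv_dnbhs_proper p q x : p < q -> x \in `[p, q] ->
  ProperFilter (within `[p, q]%classic x^').
Proof.
move=> pq; rewrite in_itv/= => /andP[px xq].
apply: Build_ProperFilter_ex => A FA.
have [xq'|qx] := ltP x q.
  by apply: (@filter_ex _ x^'+); exact: at_right_within_itv FA.
apply: (@filter_ex _ x^'-); apply: at_left_within_itv FA => //.
exact: lt_le_trans qx.
Qed.

Variables (r : nat) (p q : R) (f : R -> R).
Hypotheses (r_gt0 : (0 < r)%N) (pq : p < q) (f_Cr : extends_Cr r `[p, q] f).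

(** The extension g has a two-sided derivative at every point of [p, q], endpoints included, and
    within [p, q] its slopes are those of f. *)
Lemma branch_extension : exists g, [/\ forall x, x \in `[p, q] -> g x = f x,
  forall x, x \in `[p, q] -> derivable g x 1 &
  forall x, x \in `[p, q] -> derive_in `[p, q] f x = derive1 g x /\
    ((f y - f x) / (y - x) @[y --> within `[p, q]%classic x^'] --> derive1 g x)].
Proof.
case: f_Cr => U [g [_ DU gf [dg _]]]; exists g; split=> [x xD|x xD|x xD].
- exact: gf.
- by apply: (dg 0%N) => //; apply: DU.
have cvf : (f y - f x) / (y - x) @[y --> within `[p, q]%classic x^'] --> derive1 g x.
  have /derivable_slope_cvg gx : derivable g x 1.
    by apply: (dg 0%N) => //; apply: DU.
  have gW : (g y - g x) / (y - x) @[y --> within `[p, q]%classic x^']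
      --> derive1 g x by exact: cvg_within_filter.
  apply: cvg_trans gW; apply: near_eq_cvg; near=> y; rewrite !gf//.
  by near: y; exact: near_withinT.
split=> //; rewrite /derive_in.
have ? := within_itv_dnbhs_proper pq xD.
exact: cvg_lim.
Unshelve. all: by end_near. Qed.

Lemma derive_in_slope_cvg x : x \in `[p, q] ->
  (f y - f x) / (y - x) @[y --> within `[p, q]%classic x^']
    --> derive_in `[p, q] f x.
Proof.
by have [g [_ _ gf]] := branch_extension; move=> /gf[-> ].
Qed.

Hypothesis f_expanding : 1 < inf [set `|derive_in `[p, q] f x| | x in `[p, q]].

Lemma derive_in_ge_inf x : x \in `[p, q] ->
  inf [set `|derive_in `[p, q] f x| | x in `[p, q]] <= `|derive_in `[p, q] f x|.
Proof.
move=> xpq; apply: ge_inf; last by exists x.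
by exists 0 => _ [y _ <-].
Qed.

(** Mean value theorem for the extension, whose derivative exceeds 1 in absolute value on [p, q].
    The bound without the expansion factor is enough to make inverse branches continuous. *)
Lemma expanding_dist x y : x \in `[p, q] -> y \in `[p, q] ->
  `|x - y| <= `|f x - f y|.
Proof.
move=> xpq ypq; wlog yx : x y xpq ypq / y <= x.
  move=> wl; have [/wl->//|/ltW/wl xy] := leP y x.
  by rewrite distrC (distrC (f x)) xy.
have [g [gE dg gf]] := branch_extension.
have gD z : z \in `[y, x] -> z \in `[p, q].
  by move: xpq ypq; rewrite !in_itv/=; lra.
have [||z zyx gB] := @MVT_segment R g (derive1 g) y x yx.
- move=> z zyx; rewrite derive1E; apply: DeriveDef => //.
  by apply: dg; apply: gD; apply: subset_itv_oo_cc.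
- apply: derivable_within_continuous => z zyx.
  by apply: dg; apply: gD.
rewrite -!gE// gB normrM ler_peMl//.
have /gf[<- _] : z \in `[p, q] by exact: gD.
by apply: le_trans (derive_in_ge_inf (gD _ zyx)); exact: ltW.
Qed.

End Branch.

Section SlopeComposition.
Context {R : realType}.
Implicit Types (G H : set_system R) (f phi F : R -> R) (x y d L : R).

(** Chain rule for F composed with a local inverse phi of f: with u = phi z, the slope in z is the
    slope of F at u divided by that of f. The filters are abstract so that either side may be taken
    in the source and in the target. *)
Lemma slope_comp_cvg G H f phi F x d L : Filter G -> Filter H ->
  phi @ G `=>` H ->
  (\forall z \near G, phi z != x /\ f (phi z) = z) ->
  (f u - f x) / (u - x) @[u --> H] --> d -> d != 0 ->
  (F u - F x) / (u - x) @[u --> H] --> L ->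
  (F (phi z) - F x) / (z - f x) @[z --> G] --> L / d.
Proof.
move=> FG FH phiGH nearG fd d0 FL.
have FLphi := cvg_comp _ _ phiGH FL.
have fdphi := cvg_comp _ _ phiGH fd.
apply: cvg_trans (cvgM FLphi (cvgV d0 fdphi)).
apply: near_eq_cvg; near=> z.
have [zx fz] : phi z != x /\ f (phi z) = z by near: z.
have zx0 : phi z - x != 0 by rewrite subr_eq0.
by rewrite /= fz invf_div mulrA divfK.
Unshelve. all: by end_near. Qed.

Lemma nonexpanding_cvg G phi x y : Filter G -> G `=>` nbhs y ->
  (\forall z \near G, `|phi z - x| <= `|z - y|) -> phi @ G --> x.
Proof.
move=> FG Gy dphi; apply/cvgrPdist_lt => e e0.
have /cvgrPdist_lt/(_ _ e0) Gye : id @ G --> y := Gy.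
near=> z; rewrite distrC; apply: (@le_lt_trans _ _ `|z - y|); first by near: z.
rewrite distrC; near: z; exact: Gye.
Unshelve. all: by end_near. Qed.

End SlopeComposition.

(** * Jumps of the invariant density *)

Section Unimodal.
Context {R : realType}.
Variables (r : nat) (a c b : R) (f : R -> R).
Hypotheses (r_gt0 : (0 < r)%N) (hf : piecewise_expanding_unimodal r a c b f).
Implicit Types (x y z u v : R).

Let ac : a < c. Proof. exact: unimodal_lt_ac hf. Qed.
Let cb : c < b. Proof. exact: unimodal_lt_cb hf. Qed.
Local Notation D := (derive_in `[a, b] f).

Lemma unimodal_left_dist x y : x \in `[a, c] -> y \in `[a, c] ->
  `|x - y| <= `|f x - f y|.
Proof.
apply: (expanding_dist r_gt0 ac (unimodal_Cr_left hf)).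
exact: unimodal_expanding_left hf.
Qed.

Lemma unimodal_right_dist x y : x \in `[c, b] -> y \in `[c, b] ->
  `|x - y| <= `|f x - f y|.
Proof.
apply: (expanding_dist r_gt0 cb (unimodal_Cr_right hf)).
exact: unimodal_expanding_right hf.
Qed.

(** Away from c only one branch is visible, so [derive_in] on [a, b] agrees there with [derive_in]
    on that branch. *)
Lemma within_itv_left x : x < c ->
  within `[a, b]%classic x^' = within `[a, c]%classic x^'.
Proof.
have ltcb := cb; move=> xc; rewrite predeqE => A; rewrite /within/=.
have nx : \forall y \near x^', y < c.
  exact: (cvg_within _ (lt_nbhsl xc)).
by split; apply: filterS2 nx => y yc + yD; apply; move: yD;
  rewrite /= !in_itv/= => /andP[ya yb]; apply/andP; split; lra.
Qed.

Lemma within_itv_right x : c < x ->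
  within `[a, b]%classic x^' = within `[c, b]%classic x^'.
Proof.
have ltac := ac; move=> cx; rewrite predeqE => A; rewrite /within/=.
have nx : \forall y \near x^', c < y.
  exact: (cvg_within _ (lt_nbhsr cx)).
by split; apply: filterS2 nx => y yc + yD; apply; move: yD;
  rewrite /= !in_itv/= => /andP[ya yb]; apply/andP; split; lra.
Qed.

Lemma derive_in_left x : x < c -> D x = derive_in `[a, c] f x.
Proof. by move=> xc; rewrite /derive_in within_itv_left. Qed.

Lemma derive_in_right x : c < x -> D x = derive_in `[c, b] f x.
Proof. by move=> cx; rewrite /derive_in within_itv_right. Qed.

(** The constant is the smaller of the two branch infima. The point c is excluded because the
    one-sided slopes of f disagree there. *)
Lemma unimodal_derive_gt1 : exists2 lam : R, 1 < lam &
  forall x, x \in `[a, b] -> x != c -> lam <= `|D x|.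
Proof.
have := unimodal_expanding_left hf; set l := inf _ => l1.
have := unimodal_expanding_right hf; set m := inf _ => m1.
exists (Num.min l m); first by rewrite lt_min l1.
move=> x + /lt_total/orP[xc|cx]; rewrite in_itv/= => /andP[ax xb].
- rewrite derive_in_left// ge_min derive_in_ge_inf// in_itv/= ax.
  exact: ltW.
- rewrite derive_in_right// ge_min orbC derive_in_ge_inf// in_itv/= xb andbT.
  exact: ltW.
Qed.

Lemma unimodal_derive_neq0 x : x \in `[a, b] -> x != c -> D x != 0.
Proof.
have [lam lam1 Dlam] := unimodal_derive_gt1 => xab xc.
rewrite -normr_gt0 (lt_le_trans _ (Dlam _ xab xc))//; lra.
Qed.

Let slope_left x : x \in `[a, c] -> x < c ->
  (f y - f x) / (y - x) @[y --> within `[a, c]%classic x^'] --> D x.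
Proof.
move=> xac xc; rewrite derive_in_left//.
exact: (derive_in_slope_cvg r_gt0 ac (unimodal_Cr_left hf)).
Qed.

Let slope_right x : x \in `[c, b] -> c < x ->
  (f y - f x) / (y - x) @[y --> within `[c, b]%classic x^'] --> D x.
Proof.
move=> xcb cx; rewrite derive_in_right//.
exact: (derive_in_slope_cvg r_gt0 cb (unimodal_Cr_right hf)).
Qed.

Lemma unimodal_slope_at_right x : a <= x -> x < b -> x != c ->
  (f y - f x) / (y - x) @[y --> x^'+] --> D x.
Proof.
move=> ax xb /lt_total/orP[xc|cx].
- apply: cvg_trans (slope_left _ xc); last by rewrite in_itv/= ax ltW.
  by apply: cvg_app; exact: at_right_within_itv.
- apply: cvg_trans (slope_right _ cx); last by rewrite in_itv/= !ltW.
  by apply: cvg_app; apply: at_right_within_itv => //; exact: ltW.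
Qed.

Lemma unimodal_slope_at_left x : a < x -> x <= b -> x != c ->
  (f y - f x) / (y - x) @[y --> x^'-] --> D x.
Proof.
move=> ax xb /lt_total/orP[xc|cx].
- apply: cvg_trans (slope_left _ xc); last by rewrite in_itv/= !ltW.
  by apply: cvg_app; apply: at_left_within_itv => //; exact: ltW.
- apply: cvg_trans (slope_right _ cx); last by rewrite in_itv/= xb ltW.
  by apply: cvg_app; exact: at_left_within_itv.
Qed.

Lemma unimodal_lt_left x y : x \in `[a, c] -> y \in `[a, c] ->
  (f x < f y) = (x < y).
Proof.
move=> xac yac; apply/idP/idP; last exact: (unimodal_increasing hf).
apply: contraTT; rewrite -!leNgt le_eqVlt => /predU1P[->//|yx].
by rewrite ltW// (unimodal_increasing hf).
Qed.

Lemma unimodal_lt_right x y : x \in `[c, b] -> y \in `[c, b] ->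
  (f x < f y) = (y < x).
Proof.
move=> xcb ycb; apply/idP/idP; last by apply: (unimodal_decreasing hf).
apply: contraTT; rewrite -!leNgt le_eqVlt => /predU1P[->//|xy].
by rewrite ltW// (unimodal_decreasing hf).
Qed.

Lemma unimodal_left_preimage z : a <= z <= f c ->
  exists2 x, x \in `[a, c] & f x = z.
Proof.
move=> /andP[az zc]; apply: IVT; first exact: ltW.
  apply: continuous_subspaceW (unimodal_continuous hf) => x /=.
  by rewrite !in_itv/= => /andP[-> xc]; rewrite (le_trans xc)// ltW.
rewrite (unimodal_left_end hf); have afc : a <= f c by exact: le_trans zc.
by rewrite min_l// max_r// az.
Qed.

Lemma unimodal_right_preimage z : a <= z <= f c ->
  exists2 x, x \in `[c, b] & f x = z.
Proof.
move=> /andP[az zc]; apply: IVT; first exact: ltW.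
  apply: continuous_subspaceW (unimodal_continuous hf) => x /=.
  by rewrite !in_itv/= => /andP[cx ->]; rewrite (le_trans _ cx)// ltW.
rewrite (unimodal_right_end hf); have afc : a <= f c by exact: le_trans zc.
by rewrite min_r// max_l// az.
Qed.

End Unimodal.

Section Transfer.
Context {R : realType}.
Variables (r : nat) (a c b : R) (f rho : R -> R).
Variable mu : probability (measurableTypeR R) R.
Hypothesis hf : piecewise_expanding_unimodal r a c b f.
Hypotheses (hmu : is_acip a b f mu) (hrho : is_BV_density a c b f mu rho).
Implicit Types (x y z u v : R) (A : set R).

Local Notation D := (derive_in `[a, b] f).
Let drho : is_density mu rho. Proof. exact: BV_density_density hrho. Qed.

Lemma acip_setI A : measurable A -> mu (`[a, b]%classic `&` A) = mu A.
Proof.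
move=> mA; case: hmu => _ muI _.
have mI : measurable (`[a, b]%classic : set R) by exact: measurable_itv.
have muC : mu (~` `[a, b]%classic) = 0%E.
  by rewrite probability_setC// muI subee.
have -> : mu A = (mu (A `\` `[a, b]) + mu (A `&` `[a, b]))%E.
  exact: measureDI.
suff -> : mu (A `\` `[a, b]) = 0%E by rewrite add0e setIC.
apply/eqP; rewrite eq_le measure_ge0 andbT -muC le_measure// ?inE.
- exact: measurableD.
- exact: measurableC.
Qed.

Lemma mass_compl x : 1 - mass mu x = fine (mu (`[x, +oo[%classic : set R)).
Proof.
have -> : (`[x, +oo[%classic : set R) = ~` `]-oo, x[%classic.
  by rewrite setCitvl.
rewrite probability_setC ?fineB ?fin_num_measure//=; congr (_ - _).
rewrite /mass; have -> : (`]-oo, x]%classic : set R) = `]-oo, x[ `|` [set x].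
  by rewrite setUitv1.
rewrite measureU//= ?(is_density_set1 _ drho) ?adde0//.
by apply/seteqP; split => y //= -[/[swap] ->]; rewrite in_itv/= ltxx.
Qed.

(** By monotonicity of the branches, the preimage of ]-oo, f x] in I consists of the two outer
    pieces, up to x and from x' on; invariance then compares masses. *)
Lemma mass_unimodal x x' : a <= x < c -> c < x' <= b -> f x = f x' ->
  mass mu (f x) = mass mu x + 1 - mass mu x'.
Proof.
move=> /andP[ax xc] /andP[cx' x'b] fxx'.
have ac := unimodal_lt_ac hf; have cb := unimodal_lt_cb hf.
have fE : `[a, b]%classic `&` f @^-1` `]-oo, f x]%classic =
    `[a, b]%classic `&` (`]-oo, x]%classic `|` `[x', +oo[%classic).
  have xac : x \in `[a, c] by rewrite in_itv/= ax ltW.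
  have x'cb : x' \in `[c, b] by rewrite in_itv/= x'b ltW.
  apply/seteqP; split => y /= [yab]; rewrite !in_itv/= ?andbT => fy.
  - split => //; move: yab fy; rewrite in_itv/= => /andP[ay yb].
    have [yc|cy] := leP y c; rewrite leNgt.
      have yac : y \in `[a, c] by rewrite in_itv/= ay.
      by rewrite (unimodal_lt_left hf)// -leNgt; left.
    have ycb : y \in `[c, b] by rewrite in_itv/= yb ltW.
    by rewrite fxx' (unimodal_lt_right hf)// -leNgt; right.
  - split => //; move: yab; rewrite in_itv/= => /andP[ay yb].
    rewrite leNgt; case: fy => [yx|x'y].
      have yac : y \in `[a, c] by rewrite in_itv/= ay; lra.
      by rewrite (unimodal_lt_left hf)// -leNgt.
    have ycb : y \in `[c, b] by rewrite in_itv/= yb; lra.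
    by rewrite fxx' (unimodal_lt_right hf)// -leNgt.
case: hmu => _ _ muf.
rewrite -addrA mass_compl {1}/mass -(muf _ (measurable_itv _)) fE acip_setI.
  rewrite measureU//=; first by rewrite fineD// fin_num_measure.
  apply/seteqP; split => y //=; rewrite !in_itv/= andbT => -[yx x'y]; lra.
exact: measurableU.
Qed.

(** Differentiates [mass_unimodal] at f x along G, with the chain rule applied to the inverse
    branches phi and phi'. Separate filters H and H' are needed because the decreasing branch
    exchanges left and right. *)
Lemma mass_slope_transfer (G H H' : set_system R) (phi phi' : R -> R)
    x x' (L M M' : R) :
  ProperFilter G -> Filter H -> Filter H' -> phi @ G `=>` H -> phi' @ G `=>` H' ->
  a <= x < c -> c < x' <= b -> f x = f x' ->
  (\forall z \near G, phi z != x /\ a <= phi z < c /\ f (phi z) = z) ->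
  (\forall z \near G, phi' z != x' /\ c < phi' z <= b /\ f (phi' z) = z) ->
  (f u - f x) / (u - x) @[u --> H] --> D x ->
  (f u - f x') / (u - x') @[u --> H'] --> D x' ->
  (mass mu u - mass mu x) / (u - x) @[u --> H] --> M ->
  (mass mu u - mass mu x') / (u - x') @[u --> H'] --> M' ->
  (mass mu u - mass mu (f x)) / (u - f x) @[u --> G] --> L ->
  L = M / D x - M' / D x'.
Proof.
move=> FG FH FH' phiH phiH' xac x'cb fxx' phiG phiG' fD fD' massM massM' massL.
have Dx0 : D x != 0.
  have /andP[ax xc] := xac; apply: (unimodal_derive_neq0 hf).
    by rewrite in_itv/= ax ltW// (lt_trans xc (unimodal_lt_cb hf)).
  by rewrite lt_eqF.
have Dx'0 : D x' != 0.
  have /andP[cx' x'b] := x'cb; apply: (unimodal_derive_neq0 hf).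
    by rewrite in_itv/= x'b ltW// (lt_trans (unimodal_lt_ac hf) cx').
  by rewrite gt_eqF.
have phiN : \forall z \near G, phi z != x /\ f (phi z) = z.
  by apply: filterS phiG => z [? [_ ?]].
have phiN' : \forall z \near G, phi' z != x' /\ f (phi' z) = z.
  by apply: filterS phiG' => z [? [_ ?]].
have cv := slope_comp_cvg FG FH phiH phiN fD Dx0 massM.
have cv' := slope_comp_cvg FG FH' phiH' phiN' fD' Dx'0 massM'.
suff cvd : (mass mu u - mass mu (f x)) / (u - f x) @[u --> G] -->
    M / D x - M' / D x'.
  exact: (cvg_unique (@norm_hausdorff _ _) massL cvd).
apply: cvg_trans (cvgB cv cv'); apply: near_eq_cvg; near=> z.
have [_ [phiac fphi]] : phi z != x /\ a <= phi z < c /\ f (phi z) = z by near: z.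
have [_ [phicb fphi']] : phi' z != x' /\ c < phi' z <= b /\ f (phi' z) = z.
  by near: z.
have mz : mass mu z = mass mu (phi z) + 1 - mass mu (phi' z).
  by rewrite -mass_unimodal// fphi.
rewrite /= mz (mass_unimodal xac x'cb fxx') -fxx'.
by rewrite -mulrBl !fctE; congr (_ / _); lra.
Unshelve. all: by end_near. Qed.

End Transfer.

Lemma cvg_to_within {R : realType} (G : set_system R) (phi : R -> R) (x : R)
    (P : set R) : Filter G -> phi @ G --> x -> (\forall z \near G, P (phi z)) ->
  phi @ G `=>` within P (nbhs x).
Proof.
move=> FG phix GP A wA; have wA' := phix _ wA.
by apply: filterS2 GP wA' => z /[swap]; apply.
Qed.

(** * Transfer of one-sided limits and of jumps *)

Section JumpTransfer.
Context {R : realType}.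
Variables (r : nat) (a c b : R) (f rho : R -> R).
Variable mu : probability (measurableTypeR R) R.
Hypotheses (r_gt0 : (0 < r)%N) (hf : piecewise_expanding_unimodal r a c b f).
Hypotheses (hmu : is_acip a b f mu) (hrho : is_BV_density a c b f mu rho).
Implicit Types (x y z u v : R).

Local Notation D := (derive_in `[a, b] f).
Local Notation rhoR x := (lim (rho @ x^'+)).
Local Notation rhoL x := (lim (rho @ x^'-)).

Let slopeR x : (mass mu u - mass mu x) / (u - x) @[u --> x^'+] --> rhoR x.
Proof.
apply: mass_slope_cvg_at_right; first exact: BV_density_density hrho.
exact: (bounded_variation_line_cvg x (BV_density_bounded_variation hrho)).1.
Qed.

Let slopeL x : (mass mu u - mass mu x) / (u - x) @[u --> x^'-] --> rhoL x.
Proof.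
apply: mass_slope_cvg_at_left; first exact: BV_density_density hrho.
exact: (bounded_variation_line_cvg x (BV_density_bounded_variation hrho)).2.
Qed.

Lemma unimodal_inverse_branches : exists phi phi' : R -> R,
  forall z, a <= z <= f c -> [/\ phi z \in `[a, c], f (phi z) = z,
    phi' z \in `[c, b] & f (phi' z) = z].
Proof.
have /choice[phi phiP] : forall z, exists x, a <= z <= f c ->
    x \in `[a, c] /\ f x = z.
  move=> z; have [|] := boolP (a <= z <= f c); last by exists a.
  by move=> /(unimodal_left_preimage hf)[x]; exists x.
have /choice[phi' phi'P] : forall z, exists x, a <= z <= f c ->
    x \in `[c, b] /\ f x = z.
  move=> z; have [|] := boolP (a <= z <= f c); last by exists a.
  by move=> /(unimodal_right_preimage hf)[x]; exists x.
by exists phi, phi' => z zac; have [? ?] := phiP _ zac; have [? ?] := phi'P _ zac.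
Qed.

Section Preimages.
Variables x x' : R.
Hypotheses (xac : a <= x < c) (x'cb : c < x' <= b) (fxx' : f x = f x').

Let ax : a <= x. Proof. by case/andP: xac. Qed.
Let xc : x < c. Proof. by case/andP: xac. Qed.
Let cx' : c < x'. Proof. by case/andP: x'cb. Qed.
Let x'b : x' <= b. Proof. by case/andP: x'cb. Qed.
Let x_in : x \in `[a, c]. Proof. by rewrite in_itv/= ax ltW. Qed.
Let x'_in : x' \in `[c, b]. Proof. by rewrite in_itv/= x'b ltW. Qed.
Let c_inl : c \in `[a, c].
Proof. by rewrite in_itv/= lexx ltW// (le_lt_trans ax). Qed.
Let c_inr : c \in `[c, b].
Proof. by rewrite in_itv/= lexx ltW// (lt_le_trans cx'). Qed.

Let fxc : f x < f c. Proof. by rewrite (unimodal_lt_left hf). Qed.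

Let afx : a <= f x.
Proof.
have /(unimodal_maps hf) : x \in `[a, b].
  by rewrite in_itv/= ax ltW// (lt_le_trans (lt_trans xc cx')).
by rewrite in_itv/= => /andP[].
Qed.

(** As z decreases to f x, its left preimage decreases to x while its right preimage increases to
    x', hence the left limit at x'. Since f x < f c, both preimages exist for z close to f x. *)
Lemma density_transfer_at_right : rhoR (f x) = rhoR x / D x - rhoL x' / D x'.
Proof.
have [phi [phi' phiP]] := unimodal_inverse_branches.
have fxG : \forall z \near (f x)^'+, [/\ a <= z <= f c, z < f c & f x < z].
  near=> z; have fxz : f x < z by [].
  have zc : z < f c by near: z; exact: nbhs_right_lt.
  by split => //; rewrite (le_trans afx (ltW fxz)) ltW.
have phix : \forall z \near (f x)^'+, [/\ x < phi z, a <= phi z < c,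
    f (phi z) = z & `|phi z - x| <= `|z - f x|].
  apply: filterS fxG => z [/phiP[zac fz _ _] zc xz].
  split=> //; first by rewrite -(unimodal_lt_left hf)// fz.
    move: (zac); rewrite in_itv/= => /andP[-> _].
    by rewrite -(unimodal_lt_left hf)// fz.
  by have := unimodal_left_dist r_gt0 hf zac x_in; rewrite fz.
have phix' : \forall z \near (f x)^'+, [/\ phi' z < x', c < phi' z <= b,
    f (phi' z) = z & `|phi' z - x'| <= `|z - f x|].
  apply: filterS fxG => z [/phiP[_ _ zcb fz] zc xz].
  split=> //; first by rewrite -(unimodal_lt_right hf)// fz -fxx'.
    move: (zcb); rewrite in_itv/= => /andP[_ ->].
    by rewrite -(unimodal_lt_right hf)// fz zc.
  by have := unimodal_right_dist r_gt0 hf zcb x'_in; rewrite fz -fxx'.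
apply: (mass_slope_transfer hf hmu hrho (G := (f x)^'+) (H := x^'+)
  (H' := x'^'-) (phi := phi) (phi' := phi') _ _ _ _ _ xac x'cb fxx' _ _
  _ _ (@slopeR x) (@slopeL x') (@slopeR (f x))).
- apply: (@cvg_to_within _ _ phi x (fun u => x < u)).
    apply: (nonexpanding_cvg (y := f x)); first exact: cvg_within.
    by apply: filterS phix => z [].
  by apply: filterS phix => z [].
- apply: (@cvg_to_within _ _ phi' x' (fun u => u < x')).
    apply: (nonexpanding_cvg (y := f x)); first exact: cvg_within.
    by apply: filterS phix' => z [].
  by apply: filterS phix' => z [].
- by apply: filterS phix => z [xz ? ? _]; rewrite gt_eqF.
- by apply: filterS phix' => z [xz ? ? _]; rewrite lt_eqF.
- apply: (unimodal_slope_at_right r_gt0 hf) => //; last by rewrite lt_eqF.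
  exact: lt_le_trans (lt_trans xc cx') _.
- apply: (unimodal_slope_at_left r_gt0 hf) => //; last by rewrite gt_eqF.
  exact: le_lt_trans (lt_trans xc cx').
Unshelve. all: by end_near. Qed.

(** The mirror case. The strict inequalities give a < f x, so that points just below f x still have
    preimages. *)
Lemma density_transfer_at_left : a < x -> x' < b ->
  rhoL (f x) = rhoL x / D x - rhoR x' / D x'.
Proof.
move=> altx x'ltb; have [phi [phi' phiP]] := unimodal_inverse_branches.
have altfx : a < f x.
  rewrite -[ltLHS](unimodal_left_end hf) (unimodal_lt_left hf)//.
  by rewrite in_itv/= lexx ltW// (lt_trans altx).
have fxG : \forall z \near (f x)^'-, [/\ a <= z <= f c, z < f c & z < f x].
  near=> z; have zfx : z < f x by [].
  have az : a <= z by near: z; exact: nbhs_left_ge.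
  by split => //; rewrite ?az ?ltW// (lt_trans zfx fxc).
have phix : \forall z \near (f x)^'-, [/\ phi z < x, a <= phi z < c,
    f (phi z) = z & `|phi z - x| <= `|z - f x|].
  apply: filterS fxG => z [/phiP[zac fz _ _] zc xz].
  split=> //; first by rewrite -(unimodal_lt_left hf)// fz.
    move: (zac); rewrite in_itv/= => /andP[-> _].
    by rewrite -(unimodal_lt_left hf)// fz.
  by have := unimodal_left_dist r_gt0 hf zac x_in; rewrite fz.
have phix' : \forall z \near (f x)^'-, [/\ x' < phi' z, c < phi' z <= b,
    f (phi' z) = z & `|phi' z - x'| <= `|z - f x|].
  apply: filterS fxG => z [/phiP[_ _ zcb fz] zc xz].
  split=> //; first by rewrite -(unimodal_lt_right hf)// fz -fxx'.
    move: (zcb); rewrite in_itv/= => /andP[_ ->].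
    by rewrite -(unimodal_lt_right hf)// fz zc.
  by have := unimodal_right_dist r_gt0 hf zcb x'_in; rewrite fz -fxx'.
apply: (mass_slope_transfer hf hmu hrho (G := (f x)^'-) (H := x^'-)
  (H' := x'^'+) (phi := phi) (phi' := phi') _ _ _ _ _ xac x'cb fxx' _ _
  _ _ (@slopeL x) (@slopeR x') (@slopeL (f x))).
- apply: (@cvg_to_within _ _ phi x (fun u => u < x)).
    apply: (nonexpanding_cvg (y := f x)); first exact: cvg_within.
    by apply: filterS phix => z [].
  by apply: filterS phix => z [].
- apply: (@cvg_to_within _ _ phi' x' (fun u => x' < u)).
    apply: (nonexpanding_cvg (y := f x)); first exact: cvg_within.
    by apply: filterS phix' => z [].
  by apply: filterS phix' => z [].
- by apply: filterS phix => z [xz ? ? _]; rewrite lt_eqF.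
- by apply: filterS phix' => z [xz ? ? _]; rewrite gt_eqF.
- apply: (unimodal_slope_at_left r_gt0 hf) => //; last by rewrite lt_eqF.
  by rewrite ltW// (lt_le_trans (lt_trans xc cx')).
- apply: (unimodal_slope_at_right r_gt0 hf) => //; last by rewrite gt_eqF.
  by rewrite ltW// (le_lt_trans ax) // (lt_trans xc).
Unshelve. all: by end_near. Qed.

Let rho_left_of_a : rhoL a = 0.
Proof.
apply: cvg_lim => //; apply: cvg_near_cst; near=> z;
  rewrite (BV_density_off_I hrho)// in_itv/=.
by rewrite leNgt (_ : z < a).
Unshelve. all: by end_near. Qed.

Let rho_right_of_b : rhoR b = 0.
Proof.
apply: cvg_lim => //; apply: cvg_near_cst; near=> z;
  rewrite (BV_density_off_I hrho)// in_itv/=.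
by rewrite andbC leNgt (_ : b < z).
Unshelve. all: by end_near. Qed.

Lemma jump_transfer : jump rho (f x) = jump rho x / D x + jump rho x' / D x'.
Proof.
rewrite /jump density_transfer_at_right.
(* If x = a then x' = b and f x = a. The density vanishes to the left of a and to the right of b, so
   the transfer from the right alone gives the formula. *)
have [altx|] := ltP a x; last first.
  move=> xa; have {xa} xa : x = a by apply/eqP; rewrite eq_le xa.
  have x'b' : x' = b.
    apply/eqP; rewrite eq_le x'b leNgt -(unimodal_lt_right hf)//; last first.
      by rewrite in_itv/= lexx andbT (le_trans (ltW cx')).
    by rewrite (unimodal_right_end hf) -fxx' xa (unimodal_left_end hf) ltxx.
  rewrite xa x'b' (unimodal_left_end hf) rho_left_of_a rho_right_of_b.
  by rewrite !subr0 sub0r mulNr.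
have x'ltb : x' < b.
  rewrite -(unimodal_lt_right hf)//; last first.
    by rewrite in_itv/= lexx andbT (le_trans (ltW cx')).
  rewrite (unimodal_right_end hf) -fxx' -[ltLHS](unimodal_left_end hf).
  rewrite (unimodal_lt_left hf)// in_itv/= lexx.
  by rewrite ltW// (lt_trans altx).
rewrite density_transfer_at_left//; lra.
Qed.

End Preimages.

Lemma jump_cst_off_orbit x : (forall k, (0 < k)%N -> x <> iter k f c) ->
  jump rho x = 0.
Proof.
move=> /(BV_density_continuous hrho) rhox; rewrite /jump.
have -> : rhoR x = rho x by apply: cvg_lim => //; exact: cvg_at_right_filter.
have -> : rhoL x = rho x by apply: cvg_lim => //; exact: cvg_at_left_filter.
by rewrite subrr.
Qed.

(** Removes the reference to branches: whichever side of c contains x, its image has exactly one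
    further preimage, on the other side. This is the form used along the orbit. *)
Lemma jump_preimages x : x \in `[a, b] -> x != c ->
  exists x', [/\ x' \in `[a, b], x' != x, f x' = f x,
    forall y, y \in `[a, b] -> f y = f x -> y = x \/ y = x' &
    jump rho (f x) = jump rho x / D x + jump rho x' / D x'].
Proof.
have ac := unimodal_lt_ac hf; have cb := unimodal_lt_cb hf.
have fI z : z \in `[a, c] -> a <= f z <= f c.
  move=> zac; move: (zac); rewrite in_itv/= => /andP[az zc].
  apply/andP; split.
    have /(unimodal_maps hf) : z \in `[a, b] by rewrite in_itv/=; lra.
    by rewrite in_itv/= => /andP[].
  by rewrite leNgt (unimodal_lt_left hf) -?leNgt// in_itv/=; lra.
have fI' z : z \in `[c, b] -> a <= f z <= f c.
  move=> zcb; move: (zcb); rewrite in_itv/= => /andP[cz zb].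
  apply/andP; split.
    have /(unimodal_maps hf) : z \in `[a, b] by rewrite in_itv/=; lra.
    by rewrite in_itv/= => /andP[].
  by rewrite leNgt (unimodal_lt_right hf) -?leNgt// in_itv/=; lra.
have injl y z : y \in `[a, c] -> z \in `[a, c] -> f y = f z -> y = z.
  move=> yac zac fyz; apply/le_anti/andP.
  by split; rewrite leNgt -(unimodal_lt_left hf)// fyz ltxx.
have injr y z : y \in `[c, b] -> z \in `[c, b] -> f y = f z -> y = z.
  move=> yac zac fyz; apply/le_anti/andP.
  by split; rewrite leNgt -(unimodal_lt_right hf)// fyz ltxx.
have split_I y : y \in `[a, b] -> y \in `[a, c] \/ y \in `[c, b].
  rewrite !in_itv/= => /andP[ay yb].
  by have [yc|/ltW cy] := leP y c; [left|right]; rewrite ?ay ?yb ?cy.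
have c_inl : c \in `[a, c] by rewrite in_itv/=; lra.
have c_inr : c \in `[c, b] by rewrite in_itv/=; lra.
move=> xI xNc; have [xac|xcb] := split_I _ xI.
- have [x' x'cb fxx'] := unimodal_right_preimage hf (fI _ xac).
  (* If x' were c, then f x = f c, and injectivity of the branch would give x = c. *)
  have x'c : x' != c.
    by apply: contra_neq xNc => x'c; apply: injl; rewrite // -fxx' x'c.
  move: (xac) (x'cb); rewrite !in_itv/= => /andP[ax xc] /andP[cx' x'b].
  have {}xc : x < c by rewrite lt_neqAle xNc.
  have {}cx' : c < x' by rewrite lt_neqAle eq_sym x'c.
  exists x'; split => //.
  + by rewrite in_itv/=; lra.
  + by rewrite gt_eqF// (lt_trans xc).
  + move=> y /split_I[yac|ycb] fyx; [left|right]; first exact: injl.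
    by apply: injr => //; rewrite fxx'.
  + by apply: jump_transfer; rewrite ?ax ?cx'.
- have [x' x'ac fxx'] := unimodal_left_preimage hf (fI' _ xcb).
  have x'c : x' != c.
    by apply: contra_neq xNc => x'c; apply: injr; rewrite // -fxx' x'c.
  move: (xcb) (x'ac); rewrite !in_itv/= => /andP[cx xb] /andP[ax' x'lec].
  have {}cx : c < x by rewrite lt_neqAle eq_sym xNc.
  have {}x'lec : x' < c by rewrite lt_neqAle x'c.
  exists x'; split => //.
  + by rewrite in_itv/=; lra.
  + by rewrite lt_eqF// (lt_trans x'lec).
  + move=> y /split_I[yac|ycb] fyx; [right|left]; last exact: injr.
    by apply: injl => //; rewrite fxx'.
  + by rewrite addrC -fxx'; apply: jump_transfer; rewrite ?ax' ?cx.
Qed.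

End JumpTransfer.

(** * The cohomological equation *)

Section CohomologicalEquation.
Context {R : realType}.
Variables (r : nat) (a c b : R) (f : R -> R).
Hypothesis hf : piecewise_expanding_unimodal r a c b f.
Implicit Types (x y : R) (X alpha : R -> R).

Local Notation D := (derive_in `[a, b] f).

(** The value 0 at c encodes the normalisation alpha c = 0, so that both conditions on alpha become
    one fixed-point equation. *)
Let weight x : R := if x == c then 0 else (D x)^-1.

Let weight_le : exists2 q : R, 0 < q < 1 &
  forall x, x \in `[a, b] -> `|weight x| <= q.
Proof.
have [lam lam1 Dlam] := unimodal_derive_gt1 hf.
have lam0 : 0 < lam by lra.
exists lam^-1; first by rewrite invr_gt0 lam0 invf_lt1.
move=> x xab; rewrite /weight; case: eqP => [_|/eqP xc].
  by rewrite normr0 invr_ge0 ltW.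
rewrite normfV lef_pV2 ?Dlam// posrE// normr_gt0.
exact: (unimodal_derive_neq0 hf).
Qed.

Let alpha_weight X alpha : is_alpha0 a c b f X alpha ->
  forall x, x \in `[a, b] -> alpha x = weight x * (alpha (f x) - X (f x)).
Proof.
move=> [_ alphac alphaE] x xab; rewrite /weight; case: eqP => [->|/eqP xc].
  by rewrite mul0r.
have Dx0 := unimodal_derive_neq0 hf xab xc.
by rewrite (alphaE _ xab xc) opprB addrCA subrr addr0 mulKf.
Qed.

(** In the difference of two solutions X cancels, and each use of the equation gains a factor q < 1;
    hence the difference is at most (N + M) q^n for every n. *)
Lemma alpha0_uniq X alpha beta : is_alpha0 a c b f X alpha ->
  is_alpha0 a c b f X beta -> {in `[a, b], beta =1 alpha}.
Proof.
move=> ha hb; have [q /andP[q0 q1] wq] := weight_le.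
have [[[M alphaM] _ _] [[N betaN] _ _]] := (ha, hb).
have dist n : forall x, x \in `[a, b] -> `|beta x - alpha x| <= geometric (N + M) q n.
  elim: n => [|n IH] x xab.
    rewrite /geometric/= expr0 mulr1 (le_trans (ler_normB _ _))//.
    by rewrite lerD ?betaN ?alphaM.
  rewrite (alpha_weight ha xab) (alpha_weight hb xab) -mulrBr.
  rewrite opprB addrA subrK normrM /geometric/= exprS mulrCA.
  by rewrite ler_pM ?wq ?IH ?(unimodal_maps hf).
move=> x xab; apply/eqP; rewrite -subr_eq0 -normr_le0.
have q1' : `|q| < 1 by rewrite gtr0_norm.
rewrite -(cvg_lim _ (cvg_geometric (N + M) q1'))//.
apply: limr_ge; first by apply/cvg_ex; exists 0; exact: cvg_geometric.
by near=> n; exact: dist.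
Unshelve. all: by end_near. Qed.

(* The partial product of weights vanishes once the orbit has passed through c,
   so the series truncates by itself there. *)
Let term X : nat -> R -> R := fix term j x :=
  if j is j'.+1 then weight x * term j' (f x) else - (weight x * X (f x)).

(** The solution is the series obtained by iterating the fixed-point equation; a geometric series
    dominates it, which gives both convergence and boundedness. *)
Lemma alpha0_exists X : bounded_on `[a, b] X ->
  exists alpha, is_alpha0 a c b f X alpha.
Proof.
move=> [M XM]; have [q /andP[q0 q1] wq] := weight_le.
have q1' : `|q| < 1 by rewrite gtr0_norm.
have M0 : 0 <= M.
  apply: le_trans (XM a _) => //=; rewrite in_itv/= lexx.
  by rewrite ltW// (lt_trans (unimodal_lt_ac hf) (unimodal_lt_cb hf)).
have termM j : forall x, x \in `[a, b] -> `|term X j x| <= geometric M q j.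
  elim: j => [|j IH] x xab; rewrite /geometric/=.
    rewrite expr0 mulr1 normrN normrM -[leRHS]mul1r ler_pM//.
      by rewrite (le_trans (wq _ xab))// ltW.
    by apply: XM; exact: (unimodal_maps hf).
  by rewrite normrM exprS mulrCA ler_pM ?wq ?IH ?(unimodal_maps hf).
have geo_cvg : cvgn (series (geometric M q)) by exact: is_cvg_geometric_series.
have norm_cvg x : x \in `[a, b] -> cvgn [normed series (term X ^~ x)].
  move=> xab; apply: series_le_cvg geo_cvg => n; last exact: termM.
    exact: normr_ge0.
  by rewrite /geometric/= mulr_ge0// exprn_ge0// ltW.
have term_cvg x : x \in `[a, b] -> cvgn (series (term X ^~ x)).
  by move=> /norm_cvg; exact: normed_cvg.
pose alpha x := limn (series (term X ^~ x)).
have alphaE x : x \in `[a, b] -> alpha x = weight x * (alpha (f x) - X (f x)).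
  move=> xab; have fxab := unimodal_maps hf xab.
  (* Splitting off the first term expresses each partial sum at x through the preceding one at f
     x. *)
  apply: cvg_lim => //; rewrite -(cvg_shiftS _).
  have -> : (fun n => series (term X ^~ x) n.+1) =
      (fun n => weight x * (series (term X ^~ (f x)) n - X (f x))).
    apply/funext => n; rewrite /series/= big_nat_recl//= mulrBr mulr_sumr.
    by rewrite addrC.
  apply: cvgM; first exact: cvg_cst.
  by apply: cvgB; [exact: term_cvg | exact: cvg_cst].
exists alpha; split.
- exists (limn (series (geometric M q))) => x xab.
  apply: le_trans (lim_series_norm (norm_cvg _ xab)) _.
  apply: lim_series_le => //; first exact: norm_cvg.
  by move=> n; exact: termM.
- rewrite alphaE /weight ?eqxx ?mul0r// in_itv/=.
  by rewrite !ltW// ?(unimodal_lt_ac hf) ?(unimodal_lt_cb hf).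
- move=> x xab xc; rewrite (alphaE x)// /weight (negPf xc).
  by rewrite mulVKf ?(unimodal_derive_neq0 hf)// subKr.
Qed.

End CohomologicalEquation.

(** * Summation along the postcritical orbit *)

Lemma leastP (P : set nat) : (exists n, P n) ->
  P (least P) /\ forall m, P m -> (least P <= m)%N.
Proof.
move=> [n Pn]; have exP : exists m, `[< P m >] by exists n; apply/asboolP.
have [m /asboolP Pm minm] := ex_minnP exP.
apply: (@xgetPex _ 0%N [set n | P n /\ forall m, P m -> (n <= m)%N]); exists m.
by split => // k Pk; apply: minm; apply/asboolP.
Qed.

Section PostcriticalSum.
Context {R : realType}.
Variables (I : set R) (f : R -> R) (c : R) (s D X alpha : R -> R).
Hypothesis fI : forall x, I x -> I (f x).
Hypothesis cI : I c.
Hypothesis turning : forall x, I x -> f x = f c -> x = c.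
Hypothesis D_neq0 : forall x, I x -> x != c -> D x != 0.
Hypothesis s_off_orbit : forall x,
  (forall k, (0 < k)%N -> x <> iter k f c) -> s x = 0.
Hypothesis s_transfer : forall x, I x -> x != c -> exists x',
  [/\ I x', x' != x, f x' = f x, forall y, I y -> f y = f x -> y = x \/ y = x' &
  s (f x) = s x / D x + s x' / D x'].
Hypothesis alphac : alpha c = 0.
Hypothesis alphaE : forall x, I x -> x != c ->
  X (f x) = alpha (f x) - D x * alpha x.

Local Notation orb n := (iter n f c).

Let orbI n : I (orb n). Proof. by elim: n => //= n; exact: fI. Qed.

Let iter_eq m x y : x = y -> iter m f x = iter m f y. Proof. by move->. Qed.

(** The index k starts at 1 because jumps are supported on the points c_k with k >= 1; c itself
    counts only if it recurs. *)
Definition simple_step n := orb n != c /\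
  forall k, (0 < k)%N -> orb k.+1 = orb n.+1 -> orb k = orb n.

(** The other preimage x' of c_(n+1) is off the orbit, so it contributes no jump to the transfer
    formula. *)
Lemma simple_step_jump n : simple_step n -> s (orb n.+1) = s (orb n) / D (orb n).
Proof.
move=> [nc inj]; have [x' [x'I x'n fx' _]] := s_transfer (orbI n) nc.
rewrite iterS => ->; rewrite [s x']s_off_orbit ?mul0r ?addr0// => k k0 x'E.
by move: x'n; rewrite x'E inj ?eqxx//= -x'E.
Qed.

(** Multiplying the cohomological equation at c_n by s_(n+1) = s_n / D c_n cancels the factor D
    c_n. *)
Lemma simple_step_term n : simple_step n ->
  s (orb n.+1) * X (orb n.+1) =
  s (orb n.+1) * alpha (orb n.+1) - s (orb n) * alpha (orb n).
Proof.
move=> sn; have [nc _] := sn; rewrite (simple_step_jump sn).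
have XE := alphaE (orbI n) nc; rewrite -iterS in XE.
rewrite XE mulrBr; congr (_ - _).
by rewrite mulrA divfK// D_neq0.
Qed.

Lemma simple_steps_sum m n : (m <= n)%N ->
  (forall k, (m <= k < n)%N -> simple_step k) ->
  \sum_(m.+1 <= k < n.+1) s (orb k) * X (orb k) =
  s (orb n) * alpha (orb n) - s (orb m) * alpha (orb m).
Proof.
move=> mn step; rewrite big_add1/= (eq_big_nat _ _ (F2 := fun k =>
  s (orb k.+1) * alpha (orb k.+1) - s (orb k) * alpha (orb k))).
  by rewrite telescope_sumr.
by move=> k kmn; rewrite -simple_step_term//; exact: step.
Qed.

(** The first term is kept apart because the transfer formula excludes the step from c to c_1. What
    remains is to dispose of the boundary term at n. *)
Lemma sum_from1 n : (0 < n)%N -> (forall k, (0 < k < n)%N -> simple_step k) ->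
  \sum_(1 <= k < n.+1) s (orb k) * X (orb k) =
  s (f c) * (X (f c) - alpha (f c)) + s (orb n) * alpha (orb n).
Proof.
move=> n0 step; rewrite big_ltn// simple_steps_sum//=; ring.
Qed.

(* The qualification avoids mathcomp's periodic, about periods of functions. *)
Lemma periodic_sum : Defs.periodic f c ->
  \sum_(1 <= k < (min_period f c).+1) s (orb k) * X (orb k) =
  s (f c) * (X (f c) - alpha (f c)).
Proof.
move=> pc; have [] := @leastP [set p | (0 < p)%N /\ orb p = c] pc.
rewrite -/(min_period f c).
set p := min_period f c => -[p0 cp] minp.
(* The boundary term vanishes because c_p = c and alpha c = 0. *)
rewrite sum_from1// ?cp ?alphac ?mulr0 ?addr0// => k /andP[k0 kp]; split.
  apply/eqP => ck; have := minp k (conj k0 ck).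
  by rewrite leqNgt kp.
(* Going around the cycle by p - 1 further steps inverts f on the orbit. *)
have back j : iter p.-1 f (orb j.+1) = orb j.
  by rewrite -iterD addnS -addSn prednK// addnC iterD cp.
by move=> j _ /(iter_eq p.-1); rewrite !back.
Qed.

(** The only failures of simplicity are at n0 - 1 and at the last index N, both of which lead to
    c_(n0). The sum is split at n0, and the transfer formula for s at c_(n0), with both preimages
    present, cancels the boundary terms. *)
Lemma preperiodic_sum : ~ Defs.periodic f c -> (exists n, Defs.periodic f (orb n)) ->
  let n0 := preperiod f c in
  \sum_(1 <= k < (n0 + min_period f (orb n0) - 1).+1) s (orb k) * X (orb k) =
  s (f c) * (X (f c) - alpha (f c)).
Proof.
move=> npc exn n0; have [pn0 minn0] := @leastP [set n | Defs.periodic f (orb n)] exn.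
rewrite -/(preperiod f c) -/n0 in pn0 minn0.
have [] := @leastP [set p | (0 < p)%N /\ iter p f (orb n0) = orb n0] pn0.
rewrite -/(min_period f (orb n0)).
set p := min_period f (orb n0) => -[p0 cp] minp.
have orbc k : (0 < k)%N -> orb k != c.
  by move=> k0; apply/eqP => ck; apply: npc; exists k.
have per k : (n0 <= k)%N -> iter p f (orb k) = orb k.
  by move=> n0k; rewrite -(subnK n0k) iterD -iterD addnC iterD cp.
have back k : (n0 <= k)%N -> iter p.-1 f (orb k.+1) = orb k.
  by move=> n0k; rewrite -[RHS]per// -[in RHS](prednK p0) [RHS]iterSr.
(* A coincidence c_i = c_j makes c_i periodic, so minimality of n0 applies to i. *)
have collide i j : (i < j)%N -> orb i = orb j -> (n0 <= i)%N.
  move=> ij cij; apply: minn0; exists (j - i)%N; split; first by rewrite subn_gt0.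
  by rewrite -iterD subnK// ltnW.
(* If n0 were 1, then f c_p = f c, and [turning] would make c periodic. Hence n0 - 1 >= 1, and the
   transfer applies at c_(n0 - 1). *)
have n0_gt1 : (1 < n0)%N.
  case: (n0) pn0 cp per => [//|[|//]] _ cp per.
  suff /eqP : orb p = c by rewrite (negPf (orbc _ p0)).
  by apply: turning; [exact: orbI | rewrite -iterS -addn1 iterD cp].
set N := (n0 + p - 1)%N.
have n0N : (n0 <= N)%N by rewrite /N; lia.
have NS : orb N.+1 = orb n0.
  by rewrite -cp -iterD /N; congr (iter _ f c); lia.
(* Equal successors inside the cycle are pulled back by [back]. The case j + 1 = n0 would give a
   return to c_(n0) in fewer than p steps, because k < N. *)
have step k : (0 < k < N)%N -> k != n0.-1 -> simple_step k.
  move=> /andP[k0 kN] kn0; split; first exact: orbc.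
  move=> j j0 cjk; have [jk|kj|->//] := ltngtP j k.
  - have n0j : (n0 <= j.+1)%N by apply: (@collide _ k.+1).
    move: n0j; rewrite leq_eqVlt => /predU1P[n0j|n0j]; last first.
      by rewrite -[LHS]back// -[RHS]back ?cjk//; lia.
    suff : (p <= k.+1 - n0)%N by lia.
    apply: minp; split; first by lia.
    by rewrite -iterD subnK -?cjk -?n0j//; lia.
  - have n0k : (n0 <= k.+1)%N by apply: (@collide _ j.+1).
    by rewrite -[LHS]back -1?[RHS]back ?cjk//; lia.
have n0E : n0.-1.+1 = n0 by lia.
rewrite (big_cat_nat (n := n0)) /=; [|lia|lia].
have -> : \sum_(1 <= k < n0) s (orb k) * X (orb k) =
    s (f c) * (X (f c) - alpha (f c)) + s (orb n0.-1) * alpha (orb n0.-1).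
  rewrite -[in LHS]n0E sum_from1//; first by lia.
  by move=> k kn; apply: step; lia.
have -> : \sum_(n0 <= k < N.+1) s (orb k) * X (orb k) =
    s (orb n0) * X (orb n0) +
    (s (orb N) * alpha (orb N) - s (orb n0) * alpha (orb n0)).
  rewrite big_ltn; last by lia.
  by rewrite simple_steps_sum// => k kn; apply: step; lia.
have c0 : orb n0.-1 != c by apply: orbc; lia.
have cN : orb N != c by apply: orbc; lia.
(* The two preimages of c_(n0) are the orbit points c_(n0 - 1) and c_N. *)
have [x' [x'I x'n fx' only sE]] := s_transfer (orbI _) c0.
have {only} [NE|Nx'] : orb N = orb n0.-1 \/ orb N = x'.
    by apply: only => //; rewrite -!iterS n0E.
  have : (n0 <= n0.-1)%N by apply: (@collide _ N) => //; lia.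
  by lia.
rewrite -iterS n0E -{x' x'I x'n fx'}Nx' in sE *.
have X0 := alphaE (orbI n0.-1) c0; rewrite -iterS n0E in X0.
have XN := alphaE (orbI N) cN; rewrite -iterS NS in XN.
have D0 := D_neq0 (orbI _) c0; have DN := D_neq0 (orbI _) cN.
(* Both preimages satisfy the cohomological equation with the same image c_(n0), so the products of
   D and alpha agree at them. *)
have aN : alpha (orb N) = D (orb n0.-1) * alpha (orb n0.-1) / D (orb N).
  apply: (mulIf DN); rewrite divfK//; lra.
rewrite X0 aN sE; field.
by rewrite D0 DN.
Qed.

(** The orbit is injective, so every step from index 1 on is simple. The boundary term is a bounded
    alpha times s_n, which decays like a power of 1 / lam. *)
Lemma infinite_sum (lam M : R) : ~ (exists n, Defs.periodic f (orb n)) ->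
  1 < lam -> (forall x, I x -> x != c -> lam <= `|D x|) ->
  (forall x, I x -> `|alpha x| <= M) ->
  \sum_(1 <= k < m.+1) s (orb k) * X (orb k) @[m --> \oo] -->
  s (f c) * (X (f c) - alpha (f c)).
Proof.
move=> npo lam1 Dlam alphaM; have lam0 : 0 < lam by lra.
have inj i j : orb i = orb j -> i = j.
  wlog ij : i j / (i < j)%N.
    by move=> wl; have [/wl//|/wl + /esym|//] := ltngtP i j; move=> /[apply].
  move=> cij; exfalso; apply: npo; exists i, (j - i)%N.
  by rewrite subn_gt0 ij -iterD subnK// ltnW.
have orbc k : (0 < k)%N -> orb k != c.
  by move=> k0; apply/eqP => /(inj k 0); lia.
have step k : (0 < k)%N -> simple_step k.
  by move=> k0; split; [exact: orbc | move=> j _ /inj[->]].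
have s_le m : `|s (orb m.+1)| <= geometric `|s (f c)| lam^-1 m.
  elim: m => [|m IH]; first by rewrite /geometric/= expr0 mulr1.
  rewrite simple_step_jump; last exact: step.
  have lamD : lam <= `|D (orb m.+1)| by apply: Dlam (orbI _) (orbc _ _).
  rewrite normrM normfV [geometric _ _ _]/= exprSr mulrA ler_pM//.
  by rewrite lef_pV2// posrE (lt_le_trans lam0).
(* The index is shifted to m + 1 because [sum_from1] requires a nonempty sum. *)
set L := s (f c) * _; rewrite -cvg_shiftS; apply/cvgrPdist_le => e e0.
have q1 : `|lam^-1| < 1 by rewrite gtr0_norm ?invr_gt0// invf_lt1.
have /cvgrPdist_le/(_ _ e0) geo := cvg_geometric (`|s (f c)| * M) q1.
near=> m; rewrite [X in _ - X]sum_from1//; last by move=> k /andP[k0 _]; exact: step.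
rewrite -/L opprD addrA subrr sub0r normrN.
have : `|0 - geometric (`|s (f c)| * M) lam^-1 m| <= e by near: m.
rewrite sub0r normrN; apply: le_trans; apply: le_trans (ler_norm _).
rewrite normrM /geometric/= mulrAC; apply: ler_pM => //; first exact: s_le.
exact: (alphaM _ (orbI m.+1)).
Unshelve. all: by end_near. Qed.

End PostcriticalSum.

(** * The formula for J *)

Theorem lemma4p2 (R : realType) (a c b : R) (f X : R -> R)
    (mu : probability (measurableTypeR R) R) (rho0 : R -> R)
    (hf : piecewise_expanding_unimodal 2 a c b f)
    (hX : bounded_on `[a, b] X)
    (hmu : is_acip a b f mu)
    (hrho : is_BV_density a c b f mu rho0) :
  (exists alpha0, is_alpha0 a c b f X alpha0 /\
     forall beta, is_alpha0 a c b f X beta -> {in `[a, b], beta =1 alpha0}) /\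
  (forall alpha0, is_alpha0 a c b f X alpha0 ->
     J_converges f c rho0 X /\
     J f c rho0 X = jump rho0 (f c) * (X (f c) - alpha0 (f c))).
Proof.
split.
  have [alpha0 halpha] := alpha0_exists hf hX.
  by exists alpha0; split => // beta; exact: (alpha0_uniq hf).
move=> alpha [[M alphaM] alphac alphaE].
have ac := unimodal_lt_ac hf; have cb := unimodal_lt_cb hf.
pose I : set R := `[a, b]%classic.
have fI x : I x -> I (f x) by exact: (unimodal_maps hf).
have c_inl : c \in `[a, c] by rewrite in_itv/= lexx ltW.
have c_inr : c \in `[c, b] by rewrite in_itv/= lexx ltW.
have cI : I c by rewrite /I/= in_itv/= !ltW.
(* Strict monotonicity of the branches makes c the only point where the maximum f c is attained. *)
have turning x : I x -> f x = f c -> x = c.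
  rewrite /I/= in_itv/= => /andP[ax xb] fxc; apply/eqP.
  have [xc|cx|//] := ltgtP x c; exfalso.
  - have : f x < f c by rewrite (unimodal_lt_left hf)// in_itv/= ax ltW.
    by rewrite fxc ltxx.
  - have : f x < f c by rewrite (unimodal_lt_right hf)// in_itv/= xb ltW.
    by rewrite fxc ltxx.
have D0 x : I x -> x != c -> derive_in `[a, b] f x != 0.
  exact: (unimodal_derive_neq0 hf).
have off := jump_cst_off_orbit hrho.
have transfer : forall x, I x -> x != c -> exists x',
    [/\ I x', x' != x, f x' = f x, forall y, I y -> f y = f x -> y = x \/ y = x' &
    jump rho0 (f x) = jump rho0 x / derive_in `[a, b] f x +
                      jump rho0 x' / derive_in `[a, b] f x'].
  by move=> x; exact: (@jump_preimages _ 2 _ _ _ _ _ mu).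
have [lam lam1 Dlam] := unimodal_derive_gt1 hf.
rewrite /J_converges /J /Nf; case: pselect => [pc|npc].
  by split => //; exact: (periodic_sum fI cI D0 off transfer alphac alphaE).
case: pselect => [pn|npn].
  by split => //; exact: (preperiodic_sum fI cI turning D0 off transfer alphaE).
have cvS := infinite_sum fI cI D0 off transfer alphaE npn lam1 Dlam alphaM.
by split; [apply/cvg_ex; exists (jump rho0 (f c) * (X (f c) - alpha (f c)))
  | apply: cvg_lim].
Qed.
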